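(* Assume the standing assumptions below and let $X_*$ be the unique symmetric positive semidefinite solution of $\mathscr R(X)=0$, where $$\mathscr R(X)=A^{\mathsf T}X+XA+Q+\Pi_{11}(X)-[XB+L+\Pi_{12}(X)][R+\Pi_{22}(X)]^{-1}[XB+L+\Pi_{12}(X)]^{\mathsf T}.$$ Let $X_0$ be symmetric with $X_0\succeq X_*$, $A_{\mathrm c}(X_0)-G_{\mathrm c}(X_0)X_0$ stable, and $\mathscr R(X_0)\preceq0$, and for $k\ge0$ let $X_{k+1}$ be the stabilizing solution of the CARE $A_k^{\mathsf T}X+XA_k-XG_kX+H_k=0$ with $A_k=A_{\mathrm c}(X_k)$, $G_k=G_{\mathrm c}(X_k)$, $H_k=H_{\mathrm c}(X_k)$. Then: (i) $X_0\succeq X_1\succeq\cdots\succeq X_k\succeq X_*$ and $\mathscr R(X_k)\preceq0$ for each $k\ge0$; (ii) $\lim_{k\to\infty}X_k=X_*$.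
   Context: Data: $A,Q\in\mathbb{R}^{n\times n}$, $B,L\in\mathbb{R}^{n\times m}$, $R\in\mathbb{R}^{m\times m}$, $A_0^i\in\mathbb{R}^{n\times n}$, $B_0^i\in\mathbb{R}^{n\times m}$ ($i=1,\dots,r$); $A_0^0=A$, $B_0^0=B$. For symmetric $X$: $\Pi_{11}(X)=\sum_{i=1}^r (A_0^i)^{\mathsf T}XA_0^i$, $\Pi_{12}(X)=\sum_i (A_0^i)^{\mathsf T}XB_0^i$, $\Pi_{22}(X)=\sum_i (B_0^i)^{\mathsf T}XB_0^i$; $L_{\mathrm c}=L+\Pi_{12}$, $R_{\mathrm c}=R+\Pi_{22}$, $Q_{\mathrm c}=Q+\Pi_{11}$; $A_{\mathrm c}(X)=A-BR_{\mathrm c}(X)^{-1}L_{\mathrm c}(X)^{\mathsf T}$, $G_{\mathrm c}(X)=BR_{\mathrm c}(X)^{-1}B^{\mathsf T}$, $H_{\mathrm c}(X)=Q_{\mathrm c}(X)-L_{\mathrm c}(X)R_{\mathrm c}(X)^{-1}L_{\mathrm c}(X)^{\mathsf T}$. A matrix is stable if all its eigenvalues lie in the open left half-plane; a stabilizing solution of a CARE $\mathcal A^{\mathsf T}X+X\mathcal A-X\mathcal GX+\mathcal H=0$ is a symmetric solution with $\mathcal A-\mathcal GX$ stable. Standing assumptions: (1) $R\succ0$, $\begin{bmatrix}Q&L\\L^{\mathsf T}&R\end{bmatrix}\succeq0$; (2) there is $F\in\mathbb{R}^{m\times n}$ with $\dot S=(A+BF)S+S(A+BF)^{\mathsf T}+\sum_{i=1}^r(A_0^i+B_0^iF)S(A_0^i+B_0^iF)^{\mathsf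 T}$ exponentially stable; (3) with $C^{\mathsf T}C=Q-LR^{-1}L^{\mathsf T}$, $C\in\mathbb{R}^{p\times n}$, and $\widetilde A_0^i=A_0^i-B_0^iR^{-1}L^{\mathsf T}$, there is $K\in\mathbb{R}^{n\times p}$ with $\dot S=(\widetilde A_0^0+KC)S+S(\widetilde A_0^0+KC)^{\mathsf T}+\sum_{i=1}^r\widetilde A_0^iS(\widetilde A_0^i)^{\mathsf T}$ exponentially stable; (4) $\mathcal N(Q-LR^{-1}L^{\mathsf T})\subseteq\mathcal N(L^{\mathsf T})\cap\bigcap_i\mathcal N(A_0^i)$; (5) $(A,B)$ stabilizable and $(Q-LR^{-1}L^{\mathsf T},A)$ detectable. Under (1)–(3), $\mathscr R(X)=0$ has a unique positive semidefinite solution $X_*$, which is stabilizing. *)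

(* Defs.v *)
From HB Require Import structures.
From mathcomp Require Import all_boot all_order all_algebra.
From mathcomp Require Import all_classical all_reals all_analysis.
From mathcomp Require Import complex.
Set Implicit Arguments. Unset Strict Implicit. Unset Printing Implicit Defensive.
Import Order.TTheory GRing.Theory Num.Theory.
Import numFieldNormedType.Exports.
Local Open Scope ring_scope.

Section Defs.
Variable R : realType.

Definition sym n (M : 'M[R]_n) : Prop := M^T = M.
(* positive semidefinite quadratic form (symmetry stated separately) *)
Definition psd n (M : 'M[R]_n) : Prop :=
  forall v : 'cV[R]_n, 0 <= (v^T *m M *m v) 0 0.
Definition pd n (M : 'M[R]_n) : Prop :=
  sym M /\ forall v : 'cV[R]_n, v != 0 -> 0 < (v^T *m M *m v) 0 0.

Definition stable n (M : 'M[R]_n) : Prop :=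
  forall z : R[i], root (char_poly (map_mx (fun x : R => x%:C%C) M)) z ->
    complex.Re z < 0.

Definition exp_stable n (Lop : 'M[R]_n -> 'M[R]_n) : Prop :=
  exists c a : R, 0 < c /\ 0 < a /\
    forall S : R -> 'M[R]_n, sym (S 0) ->
      (forall t : R, is_derive t 1 S (Lop (S t))) ->
      forall t : R, 0 <= t -> `|S t| <= c * expR (- (a * t)) * `|S 0|.

Definition lyap_op n r (M : 'M[R]_n) (N : 'I_r -> 'M[R]_n) (S : 'M[R]_n)
  : 'M[R]_n :=
  M *m S + S *m M^T + \sum_(i < r) (N i *m S *m (N i)^T).

Variables (n m r : nat).
Variables (A Q : 'M[R]_n) (B L : 'M[R]_(n, m)) (Rw : 'M[R]_m).
Variables (A0 : 'I_r -> 'M[R]_n) (B0 : 'I_r -> 'M[R]_(n, m)).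
(* A0 i, B0 i stand for A_0^{i+1}, B_0^{i+1}, i = 0..r-1 *)

Definition Pi11 (X : 'M[R]_n) : 'M[R]_n := \sum_(i < r) ((A0 i)^T *m X *m A0 i).
Definition Pi12 (X : 'M[R]_n) : 'M[R]_(n, m) := \sum_(i < r) ((A0 i)^T *m X *m B0 i).
Definition Pi22 (X : 'M[R]_n) : 'M[R]_m := \sum_(i < r) ((B0 i)^T *m X *m B0 i).

Definition Lc X := L + Pi12 X.
Definition Rc X := Rw + Pi22 X.
Definition Qc X := Q + Pi11 X.
Definition Ac X := A - B *m invmx (Rc X) *m (Lc X)^T.
Definition Gc X := B *m invmx (Rc X) *m B^T.
Definition Hc X := Qc X - Lc X *m invmx (Rc X) *m (Lc X)^T.

Definition Ric (X : 'M[R]_n) : 'M[R]_n :=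
  A^T *m X + X *m A + Q + Pi11 X
  - (X *m B + L + Pi12 X) *m invmx (Rw + Pi22 X) *m (X *m B + L + Pi12 X)^T.

Definition newton_step (Xk Y : 'M[R]_n) : Prop :=
  sym Y /\
  (Ac Xk)^T *m Y + Y *m Ac Xk - Y *m Gc Xk *m Y + Hc Xk = 0 /\
  stable (Ac Xk - Gc Xk *m Y).

Definition assumption1 : Prop :=
  pd Rw /\ sym (block_mx Q L L^T Rw) /\ psd (block_mx Q L L^T Rw).

Definition assumption2 : Prop :=
  exists F : 'M[R]_(m, n),
    exp_stable (lyap_op (A + B *m F) (fun i => A0 i + B0 i *m F)).

Definition Qt : 'M[R]_n := Q - L *m invmx Rw *m L^T.
Definition At0 : 'M[R]_n := A - B *m invmx Rw *m L^T.
Definition Ati (i : 'I_r) : 'M[R]_n := A0 i - B0 i *m invmx Rw *m L^T.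

Definition assumption3 : Prop :=
  exists (p : nat) (C : 'M[R]_(p, n)), C^T *m C = Qt /\
    exists K : 'M[R]_(n, p), exp_stable (lyap_op (At0 + K *m C) Ati).

Definition assumption4 : Prop :=
  forall v : 'cV[R]_n, Qt *m v = 0 ->
    L^T *m v = 0 /\ forall i, A0 i *m v = 0.

Definition assumption5 : Prop :=
  (exists F : 'M[R]_(m, n), stable (A + B *m F)) /\
  (exists K : 'M[R]_n, stable (A + K *m Qt)).

End Defs.

(* Main.v *)
Require Import Defs.
From HB Require Import structures.
From mathcomp Require Import all_boot all_order all_algebra.
From mathcomp Require Import all_classical all_reals all_analysis.
From mathcomp Require Import complex ring lra.
Import Order.TTheory GRing.Theory Num.Theory.
Import numFieldNormedType.Exports.
Set Implicit Arguments. Unset Strict Implicit. Unset Printing Implicit Defensive.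
Local Open Scope ring_scope.

(* Write [policy X Y F] for (A + BF)^T X + X (A + BF) + sum_i N_i^T Y N_i + [I; F]^T [Q L; L^T R] [I; F]
   with N_i = A0_i + B0_i F. Completing the square in F shows that the Riccati expression whose
   terms Pi_ij are frozen at Y, called [care X Y], is the minimum of [policy X Y F] over F, attained
   at [care_gain X Y]; moreover [policy] is monotone in Y. Comparing the policies of two matrices at
   a suitable gain and applying Lyapunov's theorem gives the monotonicity statements. If
   [policy X Y F <= 0] with X, Y >= 0, an unstable mode of A + BF lies in the kernel of the cost,
   hence, by assumption 4, is an unstable mode of A unobservable through Q - L R^-1 L^T, against
   assumption 5: this yields all the stability claims, and with Kleinman's iteration the existence of
   every step. For the convergence, the noise matrices N_i of the gain of X_* vanish on the kernel of
   its cost W, so sum_i N_i^T X_* N_i <= d W for some d; Lyapunov's theorem then turns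
   X_k - X_* <= s X_* into X_{k+1} - X_* <= s d/(1+d) X_*, i.e. the convergence is linear. *)

(** * Hermitian product and Lyapunov's theorem for triangular matrices *)

Section HermitianProduct.
Local Open Scope sesquilinear_scope.
Variable C : numClosedFieldType.

Lemma trmxC_mul m n p (A : 'M[C]_(m, n)) (B : 'M[C]_(n, p)) :
  (A *m B)^t* = B^t* *m A^t*.
Proof. by rewrite trmx_mul map_mxM. Qed.

Lemma trmxCE m n (A : 'M[C]_(m, n)) i j : A^t* i j = (A j i)^*.
Proof. by rewrite !mxE. Qed.

Definition hdot n (u v : 'rV[C]_n) : C := (u *m v^t*) 0 0.

Lemma hdotC n (u v : 'rV[C]_n) : (hdot u v)^* = hdot v u.
Proof. by rewrite /hdot -trmxCE trmxC_mul trmxCK. Qed.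

Lemma hdotDl n (u v w : 'rV[C]_n) : hdot (u + v) w = hdot u w + hdot v w.
Proof. by rewrite /hdot mulmxDl mxE. Qed.

Lemma hdotDr n (u v w : 'rV[C]_n) : hdot w (u + v) = hdot w u + hdot w v.
Proof. by rewrite -hdotC hdotDl rmorphD /= !hdotC. Qed.

Lemma hdotZl n a (u v : 'rV[C]_n) : hdot (a *: u) v = a * hdot u v.
Proof. by rewrite /hdot -scalemxAl mxE. Qed.

Lemma hdotZr n a (u v : 'rV[C]_n) : hdot u (a *: v) = a^* * hdot u v.
Proof. by rewrite -hdotC hdotZl rmorphM /= hdotC. Qed.

Lemma hdotMl m n (u : 'rV[C]_m) (v : 'rV[C]_n) (M : 'M[C]_(m, n)) :
  hdot (u *m M) v = hdot u (v *m M^t*).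
Proof. by rewrite /hdot trmxC_mul trmxCK mulmxA. Qed.

Lemma hdot_row_mx m n (u v : 'rV[C]_m) (u' v' : 'rV[C]_n) :
  hdot (row_mx u u') (row_mx v v') = hdot u v + hdot u' v'.
Proof. by rewrite /hdot tr_row_mx map_col_mx mul_row_col mxE. Qed.

Lemma hdot0l n (u : 'rV[C]_n) : hdot 0 u = 0.
Proof. by rewrite /hdot mul0mx mxE. Qed.

Lemma hdot_ge0 n (u : 'rV[C]_n) : 0 <= hdot u u.
Proof. by rewrite /hdot mxE sumr_ge0// => i _; rewrite trmxCE mul_conjC_ge0. Qed.

Lemma hdot11 (u v : 'rV[C]_1) : hdot u v = u 0 0 * (v 0 0)^*.
Proof. by rewrite /hdot mxE big_ord1 trmxCE. Qed.

(* Induction on the size: pass to the Schur complement of the corner [d] of [D] if [d > 0]; if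
   [d = 0], the condition at [row_mx (t *: q) y] for all real [t] forces the rest of the first
   column of [D] to vanish. *)
Lemma trig_lyapunov n (T : 'M[C]_n) : is_trig_mx T ->
  (forall i, T i i + (T i i)^* < 0) ->
  forall D : 'M[C]_n, D^t* = D ->
  (forall u, hdot (u *m T) (u *m D) + hdot (u *m D) (u *m T) <= 0) ->
  forall u, 0 <= hdot (u *m D) u.
Proof.
move=> Ttrig; move: n T Ttrig; apply: trigsqmx_ind => [|n l c T Ttrig IH] stT D.
  by move=> _ _ u; rewrite [u]thinmx0 mul0mx hdot0l.
rewrite -[D]submxK.
move: (ulsubmx D) (ursubmx D) (dlsubmx D) (drsubmx D) => d e b D' hD.
have [hd hb he hD'] : [/\ d^t* = d, e^t* = b, b^t* = e & D'^t* = D'].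
  by move: hD; rewrite tr_block_mx map_block_mx => /eq_block_mx[].
move=> lyap.
have stl : l 0 0 + (l 0 0)^* < 0.
  by have := stT (lshift n 0); rewrite block_mxEul.
have stT' i : T i i + (T i i)^* < 0.
  by have := stT (rshift 1 i); rewrite block_mxEdr.
move: IH => /(_ stT') IH.
have eD (x : 'rV[C]_1) y : row_mx x y *m block_mx d e b D' =
    row_mx (d 0 0 *: x + y *m b) (x *m e + y *m D').
  by rewrite mul_row_block {1}[d]mx11_scalar mul_mx_scalar.
have eT (x : 'rV[C]_1) y : row_mx x y *m block_mx l 0 c T =
    row_mx (l 0 0 *: x + y *m c) (y *m T).
  by rewrite mul_row_block {1}[l]mx11_scalar mul_mx_scalar mulmx0 add0r.
have dr : (d 0 0)^* = d 0 0 by rewrite -trmxCE hd.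
have dR : d 0 0 \is Num.real by apply/CrealP.
(* At the first basis vector, [lyap] says that [d] times twice the real part of [l] is nonpositive,
   and that real part is negative. *)
have d_ge0 : 0 <= d 0 0.
  have := lyap (row_mx 1%:M 0).
  rewrite eD eT !mul0mx !addr0 !hdot_row_mx !hdot0l hdot11 -(hdotC 0) hdot0l.
  rewrite conjC0 !addr0 hdot11 !mxE eqxx !mulr1 dr mulrC -mulrDr.
  have [//|d0] := real_ge0P dR.
  by rewrite (nmulr_rle0 _ d0) => /le_lt_trans/(_ stl); rewrite ltxx.
have decomp (x : 'rV[C]_1) y :
    hdot (row_mx x y *m block_mx d e b D') (row_mx x y) =
    d 0 0 * hdot x x + hdot (y *m b) x + hdot x (y *m b) + hdot (y *m D') y.
  rewrite eD hdot_row_mx !hdotDl hdotZl hdotMl he -!addrA; congr (_ + (_ + _)).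
  by rewrite hdotMl hb.
have [d0|dN0] := eqVneq (d 0 0) 0.
  have b0 : b = 0.
    (* The diagonal entries are sums of two numbers with negative real part, hence nonzero. *)
    have Tunit : T + ((l 0 0)^*)%:M \in unitmx.
      rewrite unitmxE det_trig.
        rewrite unitfE; apply/prodf_neq0 => i _; rewrite !mxE eqxx mulr1n.
        apply/eqP => h.
        have : T i i + (T i i)^* + (l 0 0 + (l 0 0)^*) < 0.
          by rewrite -[X in _ < X](addr0 0) ltrD ?stT'.
        have h' : (T i i)^* + l 0 0 = 0.
          by rewrite -[l 0 0]conjCK -rmorphD h rmorph0.
        by rewrite [l 0 0 + _]addrC addrACA h h' addr0 ltxx.
      apply/is_trig_mxP => i j ltij; rewrite !mxE (is_trig_mxP Ttrig)//.
      by rewrite -val_eqE ltn_eqF// addr0.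
    suff h : (T + ((l 0 0)^*)%:M) *m b = 0 by rewrite -[b](mulKmx Tunit) h mulmx0.
    apply/row_matrixP => i; rewrite row0 rowE mulmxA.
    move: (delta_mx 0 i) => y.
    set q := y *m (T + ((l 0 0)^*)%:M) *m b.
    have qE : q = (l 0 0)^* *: (y *m b) + y *m T *m b.
      by rewrite /q mulmxDr mul_mx_scalar mulmxDl -scalemxAl addrC.
    suff q0 : hdot q q = 0.
      move/eqP: q0; rewrite hdot11 mul_conjC_eq0 => /eqP q0.
      by apply/matrixP => i1 i2; rewrite !ord1 q0 mxE.
    set z := hdot (y *m c) (y *m b) + hdot (y *m T) (y *m D').
    (* For real [t], [lyap] at [row_mx (t *: q) y] is affine in [t] with slope twice the squared
       norm of [q]; being bounded above, it forces [q = 0]. *)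
    have key t : t^* = t -> 2 * t * hdot q q + (z + z^*) <= 0.
      move=> tr; have := lyap (row_mx (t *: q) y).
      rewrite eD eT d0 scale0r add0r !hdot_row_mx /z rmorphD /= !hdotC.
      suff : l 0 0 * hdot (t *: q) (y *m b) + hdot (y *m T) (t *: q *m e) +
         (hdot (y *m b) (l 0 0 *: (t *: q)) + hdot (t *: q *m e) (y *m T)) = 2 * t * hdot q q.
        rewrite !hdotDl !hdotDr (hdotZl (l 0 0)) => <-; apply: le_trans.
        rewrite le_eqVlt; apply/orP; left; apply/eqP; ring.
      have -> : hdot (y *m T) (t *: q *m e) = hdot (y *m T *m b) (t *: q).
        by rewrite [RHS]hdotMl he.
      have -> : hdot (t *: q *m e) (y *m T) = hdot (t *: q) (y *m T *m b).
        by rewrite hdotMl hb.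
      have -> : 2 * t * hdot q q = hdot q (t *: q) + hdot (t *: q) q.
        by rewrite hdotZl hdotZr tr; ring.
      move: (t *: q) => x; rewrite qE hdotDl hdotDr hdotZl !hdotZr conjCK; ring.
    have := hdot_ge0 q; rewrite le_eqVlt => /orP[/eqP<-//|qgt0].
    have zr : (z + z^*)^* = z + z^* by rewrite rmorphD /= conjCK addrC.
    have qr : (hdot q q)^* = hdot q q by rewrite hdotC.
    have := key ((1 - (z + z^*)) / (2 * hdot q q)).
    rewrite rmorphM rmorphB fmorphV rmorphM /= qr zr !rmorph1 conjC_nat.
    move=> /(_ erefl); suff -> : 2 * ((1 - (z + z^*)) / (2 * hdot q q)) * hdot q q + (z + z^*) = 1.
      by rewrite ler10.
    by field; rewrite gt_eqF.
  move=> u; rewrite -[u]hsubmxK decomp b0 d0.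
  rewrite !mulmx0 mul0r hdot0l -(hdotC 0) hdot0l conjC0 !add0r.
  apply: IH => // y.
  have := lyap (row_mx 0 y).
  by rewrite eD eT !mul0mx b0 !mulmx0 !(scaler0, add0r) !hdot_row_mx -(hdotC 0) hdot0l conjC0 !add0r.
pose S := D' - (d 0 0)^-1 *: (b *m e).
have dVr : ((d 0 0)^-1)^* = (d 0 0)^-1 by rewrite fmorphV /= dr.
have Sh : S^t* = S.
  have: (b *m e)^t* = b *m e by rewrite trmxC_mul he hb.
  rewrite /S; move: (b *m e) hD' dVr => be; move: (d 0 0)^-1 => z.
  move=> hD' zr hbe; apply/matrixP => i j; rewrite trmxCE 4!mxE.
  by rewrite [in RHS]mxE [in RHS]mxE rmorphB rmorphM /= zr -!trmxCE hD' hbe.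
(* The block matrix sends these vectors to vectors with zero first component, so there [lyap]
   becomes the same condition for [T] and [S]. *)
have eS (y : 'rV[C]_n) : row_mx (- (d 0 0)^-1 *: (y *m b)) y *m block_mx d e b D' = row_mx 0 (y *m S).
  rewrite eD scalerA mulrN divff// scaleN1r addNr; congr row_mx.
  by rewrite mulmxBr -scalemxAr scaleNr mulNmx -scalemxAl mulmxA addrC.
have psdS : forall y, 0 <= hdot (y *m S) y.
  apply: IH => // y; have := lyap (row_mx (- (d 0 0)^-1 *: (y *m b)) y).
  by rewrite eS eT !hdot_row_mx -(hdotC 0) hdot0l conjC0 !add0r.
move=> u; rewrite -[u]hsubmxK; move: (lsubmx u) (rsubmx u) => x y.
rewrite decomp.
have -> : d 0 0 * hdot x x + hdot (y *m b) x + hdot x (y *m b) + hdot (y *m D') y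
  = d 0 0 * hdot (x + (d 0 0)^-1 *: (y *m b)) (x + (d 0 0)^-1 *: (y *m b)) + hdot (y *m S) y.
  rewrite mulmxBr -scalemxAr mulmxA !hdotDl !hdotDr -!scaleNr !hdotZl !hdotZr.
  rewrite [hdot (y *m b *m e) y]hdotMl hb dVr; field.
  by rewrite dN0.
by rewrite addr_ge0 ?psdS// mulr_ge0 ?hdot_ge0.
Qed.
End HermitianProduct.

(** * Passage to complex matrices: modes and Lyapunov's theorem over the reals *)

Lemma char_poly_trmx (F : comNzRingType) n (M : 'M[F]_n) : char_poly M^T = char_poly M.
Proof.
rewrite /char_poly -[RHS]det_tr; congr (\det _).
by apply/matrixP => i j; rewrite !mxE eq_sym.
Qed.

Section Complexification.
Local Open Scope sesquilinear_scope.
Variable R : realType.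
Local Notation toC := (map_mx (fun x : R => x%:C%C)).

Definition cmx m n (x y : 'M[R]_(m, n)) : 'M[R[i]]_(m, n) :=
  \matrix_(i, j) Complex (x i j) (y i j).

Lemma cmxE m n (x y : 'M[R]_(m, n)) : cmx x y = toC x + 'i%C *: toC y.
Proof.
by apply/matrixP => i j; rewrite !mxE; simpc.
Qed.

Lemma cmx_inj m n (x y x' y' : 'M[R]_(m, n)) : cmx x y = cmx x' y' -> x = x' /\ y = y'.
Proof.
by move=> /matrixP h; split; apply/matrixP => i j; have := h i j; rewrite !mxE => -[].
Qed.

Lemma cmx_ReIm m n (u : 'M[R[i]]_(m, n)) :
  u = cmx (map_mx (@complex.Re R) u) (map_mx (@complex.Im R) u).
Proof. by apply/matrixP => i j; rewrite !mxE; case: (u i j). Qed.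

Lemma mul_cmx_real m n p (x y : 'M[R]_(m, n)) (M : 'M[R]_(n, p)) :
  cmx x y *m toC M = cmx (x *m M) (y *m M).
Proof. by rewrite !cmxE !map_mxM mulmxDl scalemxAl. Qed.

Lemma scale_cmx m n a b (x y : 'M[R]_(m, n)) :
  Complex a b *: cmx x y = cmx (a *: x - b *: y) (b *: x + a *: y).
Proof. by apply/matrixP => i j; rewrite !mxE; simpc; rewrite [_ * y i j + _]addrC. Qed.

Lemma cmx_eq0 m n (x y : 'M[R]_(m, n)) : (cmx x y == 0) = (x == 0) && (y == 0).
Proof.
have c0 : 0 = cmx 0 0 :> 'M[R[i]]_(m, n) by apply/matrixP => i j; rewrite !mxE.
apply/eqP/andP => [|[/eqP-> /eqP->]]; last by rewrite -c0.
by rewrite c0 => /cmx_inj[-> ->].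
Qed.

(** [x] and [y] are the real and imaginary parts of an eigenvector for [a + ib]. Eigenvectors being
    rows, it is taken for the transpose, which has the same characteristic polynomial. *)
Lemma unstable_mode n (M : 'M[R]_n) : ~ stable M ->
  exists (a b : R) (x y : 'cV[R]_n), [/\ 0 <= a, ~~ ((x == 0) && (y == 0)),
    M *m x = a *: x - b *: y & M *m y = b *: x + a *: y].
Proof.
move=> /existsNP[[a b]] /not_implyP[rt /negP]; rewrite -leNgt /= => a_ge0.
move: rt; rewrite -char_poly_trmx -eigenvalue_root_char map_trmx => /eigenvalueP[u].
rewrite [u]cmx_ReIm; move: (map_mx _ u) (map_mx _ u) => y x.
rewrite mul_cmx_real scale_cmx cmx_eq0 => /cmx_inj[ex ey] nz.
exists a, b, x^T, y^T; split => //; first by rewrite !trmx_eq0.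
  by rewrite -[M]trmxK -trmx_mul ex; apply/matrixP => i j; rewrite !mxE.
by rewrite -[M]trmxK -trmx_mul ey; apply/matrixP => i j; rewrite !mxE.
Qed.

Lemma stable_mode n (M : 'M[R]_n) (a b : R) (x y : 'cV[R]_n) : stable M -> 0 <= a ->
  M *m x = a *: x - b *: y -> M *m y = b *: x + a *: y -> x = 0 /\ y = 0.
Proof.
move=> stM a_ge0 ex ey.
have [/andP[/eqP-> /eqP->]//|nz] := boolP ((x == 0) && (y == 0)).
suff /stM /= : root (char_poly (toC M)) (Complex a b) by rewrite ltNge a_ge0.
rewrite -char_poly_trmx -eigenvalue_root_char map_trmx; apply/eigenvalueP.
exists (cmx x^T y^T); last by rewrite cmx_eq0 !trmx_eq0.
rewrite mul_cmx_real scale_cmx -!trmx_mul ex ey.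
by congr cmx; apply/matrixP => i j; rewrite !mxE.
Qed.

Definition qf n (M : 'M[R]_n) (v : 'cV[R]_n) : R := (v^T *m M *m v) 0 0.

Lemma conjC_real (x : R) : (x%:C%C)^* = x%:C%C.
Proof. by have /CrealP : x%:C%C \is Num.real by rewrite complex_real. Qed.

Lemma hdot_cmx n (a b c d : 'rV[R]_n) :
  hdot (cmx a b) (cmx c d) + hdot (cmx c d) (cmx a b) =
  (2 * ((a *m c^T) 0 0 + (b *m d^T) 0 0))%:C%C.
Proof.
rewrite /hdot !mxE -!big_split /= mulr_sumr rmorph_sum; apply: eq_bigr => i _.
rewrite !mxE; apply/eqP; rewrite eq_complex; simpc; apply/andP; split; apply/eqP => /=; ring.
Qed.

(** Lyapunov's theorem: a unitary Schur triangularization of [M^T] reduces it to [trig_lyapunov]. *)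
Lemma lyapunov_psd n (M D : 'M[R]_n) : stable M -> sym D ->
  psd (- (M^T *m D + D *m M)) -> psd D.
Proof.
case: n M D => [|n] M D stM symD lyap v; first by rewrite [v]flatmx0 mulmx0 mxE.
have [P Punit] := Schur (toC M^T) isT; rewrite /mxred.similar_to conjymx//.
set T := P *m _ *m _ => trT.
have PT : P *m toC M^T = T *m P by rewrite /T mulmxKtV.
pose E := P *m toC D *m P^t*.
have toCt k l (N : 'M[R]_(k, l)) : (toC N)^t* = toC N^T.
  by apply/matrixP => i j; rewrite !mxE conjC_real.
have herm_toC : (toC D)^t* = toC D by rewrite toCt symD.
have hE : E^t* = E by rewrite /E !trmxC_mul trmxCK herm_toC mulmxA.
have stT i : T i i + (T i i)^* < 0.
  have : root (char_poly (toC M)) (T i i).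
    rewrite -char_poly_trmx -eigenvalue_root_char map_trmx.
    have : eigenvalue T (T i i).
      rewrite eigenvalue_root_char char_poly_trig// rootE horner_prod.
      by rewrite (bigD1 i)//= hornerXsubC subrr mul0r.
    move=> /eigenvalueP[u uT u0]; apply/eigenvalueP; exists (u *m P).
      by rewrite -mulmxA PT mulmxA uT scalemxAl.
    by rewrite mulmx_free_eq0// row_free_unit unitarymx_unit.
  move=> /stM; case: (T i i) => a b /=; rewrite ltcE /=; lra.
have hdotP (u w : 'rV[R[i]]_n.+1) : hdot (u *m P^t*) (w *m P^t*) = hdot u w.
  by rewrite hdotMl trmxCK mulmxKtV.
(* Undoing the change of basis gives the Lyapunov form of [D] at [u *m P], which is the sum of its
   values at the real and imaginary parts. *)
have key (u : 'rV_n.+1) : hdot (u *m T) (u *m E) + hdot (u *m E) (u *m T) <= 0.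
  rewrite /T /E !mulmxA !hdotP [u *m P]cmx_ReIm.
  move: (map_mx _ _) (map_mx _ _) => x y.
  rewrite !mul_cmx_real hdot_cmx lecR.
  have half (z : 'rV[R]_n.+1) : 2 * (z *m M^T *m (z *m D)^T) 0 0 =
      - qf (- (M^T *m D + D *m M)) z^T.
    rewrite /qf trmxK mulmxN mulNmx [in RHS]mxE opprK mulmxDr mulmxDl [in RHS]mxE.
    have -> : (z *m (D *m M) *m z^T) = (z *m (M^T *m D) *m z^T)^T.
      by rewrite !trmx_mul !trmxK symD !mulmxA.
    by rewrite [(_^T) 0 0]mxE mulr_natl mulr2n trmx_mul symD !mulmxA.
  by rewrite mulrDr !half -opprD oppr_le0 addr_ge0// lyap.
have := trig_lyapunov trT stT hE key (toC v^T *m P^t*).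
rewrite /E !mulmxA mulmxKtV// hdotP -map_mxM /hdot toCt trmxK -map_mxM mxE.
by rewrite ler0c.
Qed.

End Complexification.

(** * Real quadratic forms and domination by a semidefinite matrix *)

Section QuadraticForms.
Variable R : realType.
Implicit Types n : nat.

Lemma qfD n (M N : 'M[R]_n) v : qf (M + N) v = qf M v + qf N v.
Proof. by rewrite /qf mulmxDr mulmxDl mxE. Qed.

Lemma qfN n (M : 'M[R]_n) v : qf (- M) v = - qf M v.
Proof. by rewrite /qf mulmxN mulNmx mxE. Qed.

Lemma qfB n (M N : 'M[R]_n) v : qf (M - N) v = qf M v - qf N v.
Proof. by rewrite qfD qfN. Qed.

Lemma qfZ n a (M : 'M[R]_n) v : qf (a *: M) v = a * qf M v.
Proof. by rewrite /qf -scalemxAr -scalemxAl mxE. Qed.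

Lemma qf0 n (v : 'cV[R]_n) : qf 0 v = 0.
Proof. by rewrite /qf mulmx0 mul0mx mxE. Qed.

Lemma qf_sum n (I : finType) (F : I -> 'M[R]_n) v :
  qf (\sum_i F i) v = \sum_i qf (F i) v.
Proof. by apply: (big_morph (fun M => qf M v)) => [M N|]; rewrite ?qfD ?qf0. Qed.

Lemma qf_congr m n (M : 'M[R]_m) (N : 'M[R]_(m, n)) v :
  qf (N^T *m M *m N) v = qf M (N *m v).
Proof. by rewrite /qf trmx_mul !mulmxA. Qed.

Lemma qf_tr n (M : 'M[R]_n) v : qf M^T v = qf M v.
Proof.
rewrite /qf (_ : v^T *m M^T *m v = (v^T *m M *m v)^T) 1?mxE//.
by rewrite !trmx_mul trmxK mulmxA.
Qed.

Lemma qf_addv n (M : 'M[R]_n) u v : sym M ->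
  qf M (u + v) = qf M u + qf M v + 2 * (u^T *m M *m v) 0 0.
Proof.
move=> symM; rewrite /qf [(u + v)^T]linearD /= !(mulmxDl, mulmxDr).
have -> : v^T *m M *m u = (u^T *m M *m v)^T by rewrite !trmx_mul trmxK symM mulmxA.
move: (u^T *m M *m u) (v^T *m M *m v) (u^T *m M *m v) => p q s.
by rewrite !mxE; ring.
Qed.

Lemma qf_scalev n (M : 'M[R]_n) a v : qf M (a *: v) = a ^+ 2 * qf M v.
Proof.
by rewrite /qf [(a *: v)^T]linearZ /= -!scalemxAl -scalemxAr scalerA mxE expr2.
Qed.

Lemma qf1E n (v : 'cV[R]_n) : qf 1%:M v = \sum_i v i 0 ^+ 2.
Proof. by rewrite /qf mulmx1 mxE; apply: eq_bigr => i _; rewrite mxE expr2. Qed.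

Lemma qf1_ge0 n (v : 'cV[R]_n) : 0 <= qf 1%:M v.
Proof. by rewrite qf1E sumr_ge0// => i _; rewrite sqr_ge0. Qed.

Lemma qf1_eq0 n (v : 'cV[R]_n) : qf 1%:M v = 0 -> v = 0.
Proof.
rewrite qf1E => /eqP; rewrite psumr_eq0; last by move=> i _; exact: sqr_ge0.
move=> /allP h; apply/matrixP => i j; rewrite ord1 mxE; apply/eqP.
by rewrite -sqrf_eq0; have := h i; rewrite mem_index_enum; apply.
Qed.

Lemma qf_bound n (M : 'M[R]_n) : exists2 c : R, 0 < c & forall v, qf M v <= c * qf 1%:M v.
Proof.
exists (1 + \sum_i \sum_j `|M i j|) => [|v].
  by rewrite ltr_pwDl// sumr_ge0// => i _; rewrite sumr_ge0.
rewrite mulrDl mul1r -[X in X <= _]add0r lerD ?qf1_ge0//.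
rewrite /qf mxE; under eq_bigr do rewrite mxE mulr_suml.
rewrite exchange_big /= mulr_suml ler_sum// => i _.
rewrite mulr_suml ler_sum// => j _; rewrite mxE.
have sq k : v k 0 ^+ 2 <= qf 1%:M v.
  by rewrite qf1E (bigD1 k)//= lerDl sumr_ge0// => l _; rewrite sqr_ge0.
rewrite (le_trans (ler_norm _))// mulrAC normrM mulrC ler_wpM2l//.
rewrite normrM; have := sqr_ge0 (`|v i 0| - `|v j 0|).
by rewrite -/(qf _ _) sqrrB !real_normK ?num_real//; have := sq i; have := sq j; lra.
Qed.

(* Minimising [qf W (v - t W v)] over [t]. *)
Lemma psd_gram n (W : 'M[R]_n) : sym W -> psd W ->
  exists2 c : R, 0 < c & forall v, qf 1%:M (W *m v) <= c * qf W v.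
Proof.
move=> symW psdW; have [c c0 hc] := qf_bound W; exists c => // v.
(* The value [t = 1/c] suffices: by the choice of [c], the quadratic term offsets at most half of
   the linear one. *)
have := psdW (v + - c^-1 *: (W *m v)); rewrite -/(qf _ _) qf_addv// qf_scalev.
have -> : (v^T *m W *m (- c^-1 *: (W *m v))) 0 0 = - c^-1 * qf 1%:M (W *m v).
  by rewrite -scalemxAr mxE /qf mulmx1 trmx_mul symW.
rewrite sqrrN => h.
have h2 : c^-1 ^+ 2 * qf W (W *m v) <= c^-1 * qf 1%:M (W *m v).
  rewrite expr2 -mulrA ler_pM2l ?invr_gt0// -ler_pdivlMl ?invr_gt0// invrK.
  exact: hc.
by rewrite -ler_pdivrMl//; lra.
Qed.

Lemma psd_kernel n (W : 'M[R]_n) v : sym W -> psd W -> qf W v = 0 -> W *m v = 0.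
Proof.
move=> symW psdW q0; have [c _ /(_ v)] := psd_gram symW psdW.
by rewrite q0 mulr0 => h; apply: qf1_eq0; apply: le_anti; rewrite h qf1_ge0.
Qed.

Lemma eq_mulmx_col m n (A B : 'M[R]_(m, n)) :
  (forall v : 'cV_n, A *m v = B *m v) -> A = B.
Proof.
move=> AB; apply/trmx_inj/row_matrixP => i.
by rewrite -!tr_col !colE AB.
Qed.

Lemma psd_antisym n (W : 'M[R]_n) : sym W -> psd W -> psd (- W) -> W = 0.
Proof.
move=> symW psdW psdNW; apply: eq_mulmx_col => v; rewrite mul0mx.
apply: psd_kernel => //; apply: le_anti; rewrite psdW andbT -oppr_ge0 -qfN.
exact: psdNW.
Qed.

(** Inclusion of kernels gives inclusion of row spaces, since the columns of [cokermx W] lie in the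
    kernel of [W]. *)
Lemma mulmx_factor m n p (W : 'M[R]_(m, n)) (N : 'M[R]_(p, n)) :
  (forall v : 'cV_n, W *m v = 0 -> N *m v = 0) -> exists K, N = K *m W.
Proof.
move=> ker; apply/submxP; rewrite submxE; apply/eqP/eq_mulmx_col => v.
by rewrite -mulmxA ker ?mul0mx// mulmxA mulmx_coker mul0mx.
Qed.

(** Writing [N = K W] bounds the left side by a multiple of the squared norm of [W v], which
    [psd_gram] bounds by the form of [W]. *)
Lemma psd_dominates n p (W : 'M[R]_n) (P : 'M[R]_p) (N : 'M[R]_(p, n)) :
  sym W -> psd W -> (forall v : 'cV_n, W *m v = 0 -> N *m v = 0) ->
  exists2 c : R, 0 <= c & forall v, qf P (N *m v) <= c * qf W v.
Proof.
move=> symW psdW ker; have [K ->] := mulmx_factor ker.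
have [a a0 ha] := psd_gram symW psdW.
have [b b0 hb] := qf_bound (K^T *m P *m K).
exists (b * a) => [|v]; first by rewrite mulr_ge0 ?ltW.
rewrite -mulmxA -qf_congr (le_trans (hb _))// -mulrA ler_pM2l//.
Qed.

Lemma psd_dominates_sum n p r (W : 'M[R]_n) (P : 'M[R]_p) (N : 'I_r -> 'M[R]_(p, n)) :
  sym W -> psd W -> (forall i (v : 'cV_n), W *m v = 0 -> N i *m v = 0) ->
  exists2 c : R, 0 <= c & forall v, qf (\sum_(i < r) (N i)^T *m P *m N i) v <= c * qf W v.
Proof.
move=> symW psdW ker.
have /choice[c hc] i : exists c, 0 <= c /\ forall v, qf P (N i *m v) <= c * qf W v.
  by have [c c0 hc] := psd_dominates P symW psdW (ker i); exists c.
exists (\sum_i c i) => [|v]; first by rewrite sumr_ge0// => i _; have [] := hc i.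
by rewrite qf_sum mulr_suml ler_sum// => i _; rewrite qf_congr; have [] := hc i.
Qed.

End QuadraticForms.

(** * Solvability of the Lyapunov equation *)

Section Lyapunov.
Variables (R : realType) (n : nat) (M : 'M[R]_n).

(* On symmetric matrices this is twice the Lyapunov operator, and on skew ones
   it is injective for trivial reasons, so that its invertibility follows from
   the symmetric case alone. *)
Definition lyap_ext (Z : 'M[R]_n) : 'M[R]_n :=
  M^T *m (Z + Z^T) + (Z + Z^T) *m M + (Z - Z^T).

Lemma lyap_ext_is_linear : linear lyap_ext.
Proof.
move=> a X Y; apply/matrixP => i j; rewrite /lyap_ext [(a *: X + Y)^T]linearD /= [(a *: X)^T]linearZ /=.
rewrite [in X in M^T *m X](_ : a *: X + Y + (a *: X^T + Y^T) = a *: (X + X^T) + (Y + Y^T)); last first.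
  by rewrite scalerDr addrACA.
rewrite [in X in X *m M](_ : a *: X + Y + (a *: X^T + Y^T) = a *: (X + X^T) + (Y + Y^T)); last first.
  by rewrite scalerDr addrACA.
rewrite mulmxDr mulmxDl -scalemxAr -scalemxAl.
move: (M^T *m _) (M^T *m _) (_ *m M) (_ *m M) => U1 U2 U3 U4.
by rewrite !mxE; ring.
Qed.
HB.instance Definition _ := GRing.isLinear.Build R _ _ _ lyap_ext lyap_ext_is_linear.

Lemma lyapunov_eq0 D : stable M -> sym D -> M^T *m D + D *m M = 0 -> D = 0.
Proof.
move=> stM symD eD; apply: psd_antisym => //; apply: (lyapunov_psd stM) => //.
- by rewrite eD oppr0 => v; rewrite -/(qf _ _) qf0.
- by rewrite /sym linearN /= symD.
- by rewrite mulmxN mulNmx -opprD eD !oppr0 => v; rewrite -/(qf _ _) qf0.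
Qed.

(** [lyap_ext Z] minus its transpose is [2 (Z - Z^T)], so kernel elements and preimages of symmetric
    matrices are symmetric. With [lyapunov_eq0] the kernel is zero, hence [lyap_ext] is onto by
    finite dimension. *)
Lemma lyapunov_solvable W : stable M -> sym W ->
  exists2 D, sym D & M^T *m D + D *m M = W.
Proof.
move=> stM symW.
have symD (Z : 'M[R]_n) : sym (Z + Z^T) by rewrite /sym linearD /= trmxK addrC.
have skewE (Z : 'M[R]_n) : lyap_ext Z - (lyap_ext Z)^T = (Z - Z^T) *+ 2.
  have e : (Z + Z^T) *m M = (M^T *m (Z + Z^T))^T by rewrite trmx_mul trmxK symD.
  rewrite /lyap_ext e; move: (M^T *m _) => N.
  by apply/matrixP => i j; rewrite mulr2n !mxE; ring.
have unitL : lin_mx lyap_ext \in unitmx.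
  rewrite -row_free_unit -kermx_eq0; apply/eqP/row_matrixP => i; rewrite row0.
  have := row_sub i (kermx (lin_mx lyap_ext)); move: (row i _) => u /sub_kermxP.
  rewrite -[u]vec_mxK mul_vec_lin /=; move: (vec_mx u) => Z /eqP.
  rewrite mxvec_eq0 => /eqP LZ0.
  have Zsym : Z - Z^T = 0.
    have := skewE Z; rewrite LZ0 linear0 subr0 => /eqP; rewrite eq_sym.
    by rewrite -scaler_nat scaler_eq0 pnatr_eq0 => /eqP.
  have := LZ0; rewrite /lyap_ext Zsym addr0 => /(lyapunov_eq0 stM (symD Z)).
  move/eqP: Zsym; rewrite subr_eq0 => /eqP <- /eqP.
  by rewrite -mulr2n -scaler_nat scaler_eq0 pnatr_eq0 => /eqP->; rewrite linear0.
pose Z := vec_mx (mxvec W *m invmx (lin_mx lyap_ext)).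
have LZ : lyap_ext Z = W.
  by apply: (can_inj mxvecK); rewrite -mul_vec_lin /= /Z vec_mxK mulmxKV.
exists (Z + Z^T) => //.
have := skewE Z; rewrite LZ symW subrr => /eqP; rewrite eq_sym.
rewrite -scaler_nat scaler_eq0 pnatr_eq0 => /eqP Z0.
by rewrite -[RHS]LZ /lyap_ext Z0 addr0.
Qed.

End Lyapunov.

(** * Comparison through Lyapunov operators, completion of squares *)

Section Positivity.
Variable R : realType.

Lemma pd_unitmx n (M : 'M[R]_n) : pd M -> M \in unitmx.
Proof.
case=> symM pdM; have ker (v : 'cV_n) : M *m v = 0 -> 1%:M *m v = 0.
  move=> Mv; rewrite mul1mx; apply/eqP/negP => /negP /pdM.
  by rewrite -mulmxA Mv mulmx0 mxE ltxx.
by have [K /esym /mulmx1_unit[]] := mulmx_factor ker.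
Qed.

Lemma pd_psd n (M : 'M[R]_n) : pd M -> psd M.
Proof.
case=> _ pdM v; have [->|/pdM/ltW//] := eqVneq v 0.
by rewrite mulmx0 mxE.
Qed.

Lemma pd_eq0 n (M : 'M[R]_n) v : pd M -> qf M v = 0 -> v = 0.
Proof.
case=> _ pdM q0; apply/eqP/negP => /negP /pdM.
by rewrite -/(qf _ _) q0 ltxx.
Qed.

Definition lyap n (M X : 'M[R]_n) := M^T *m X + X *m M.

Definition congr_sum n r (N : 'I_r -> 'M[R]_n) (Y : 'M[R]_n) :=
  \sum_(i < r) (N i)^T *m Y *m N i.

Lemma lyapB n (M X Y : 'M[R]_n) : lyap M (X - Y) = lyap M X - lyap M Y.
Proof. by rewrite /lyap mulmxBr mulmxBl opprD addrACA. Qed.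

(** Inverting the Lyapunov operator of a stable matrix reverses the order. This turns inequalities
    between policies at one gain into inequalities between matrices. *)
Lemma lyap_le n (M X Y : 'M[R]_n) : stable M -> sym X -> sym Y ->
  (forall v, qf (lyap M X) v <= qf (lyap M Y) v) -> psd (X - Y).
Proof.
move=> stM symX symY h; apply: (lyapunov_psd stM).
  by rewrite /sym linearB /= symX symY.
by move=> v; rewrite -/(lyap _ _) -/(qf _ _) lyapB qfN qfB opprB subr_ge0.
Qed.

Lemma qf_congr_sum n r (N : 'I_r -> 'M[R]_n) Y v :
  qf (congr_sum N Y) v = \sum_i qf Y (N i *m v).
Proof. by rewrite qf_sum; apply: eq_bigr => i _; rewrite qf_congr. Qed.

Lemma congr_sum_le n r (N : 'I_r -> 'M[R]_n) X Y v :
  psd (Y - X) -> qf (congr_sum N X) v <= qf (congr_sum N Y) v.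
Proof.
move=> XY; rewrite !qf_congr_sum ler_sum// => i _.
by rewrite -subr_ge0 -qfB XY.
Qed.

Lemma congr_sum_ge0 n r (N : 'I_r -> 'M[R]_n) Y v :
  psd Y -> 0 <= qf (congr_sum N Y) v.
Proof. by move=> Y0; rewrite qf_congr_sum sumr_ge0// => i _; exact: Y0. Qed.

Lemma sym_congr_sum n r (N : 'I_r -> 'M[R]_n) Y : sym Y -> sym (congr_sum N Y).
Proof.
move=> symY; rewrite /sym /congr_sum linear_sum; apply: eq_bigr => i _ /=.
by rewrite !trmx_mul trmxK symY mulmxA.
Qed.

(** The Hermitian form of [M^T X + X M] at the eigenvector [x + iy] is twice the real part of the
    eigenvalue times the form of [X]. *)
Lemma qf_lyap_mode n (M X : 'M[R]_n) (a b : R) (x y : 'cV[R]_n) : sym X ->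
  M *m x = a *: x - b *: y -> M *m y = b *: x + a *: y ->
  qf (lyap M X) x + qf (lyap M X) y = 2 * a * (qf X x + qf X y).
Proof.
move=> symX ex ey.
have half z : qf (lyap M X) z = 2 * (z^T *m X *m (M *m z)) 0 0.
  rewrite /lyap qfD -(trmxK (M^T *m X)) qf_tr trmx_mul trmxK symX /qf !mulmxA.
  by rewrite mulr_natl mulr2n.
have xy : (y^T *m X *m x) 0 0 = (x^T *m X *m y) 0 0.
  have -> : y^T *m X *m x = (x^T *m X *m y)^T by rewrite !trmx_mul trmxK symX mulmxA.
  by rewrite mxE.
rewrite !half ex ey mulmxBr mulmxDr -!scalemxAr /qf; move: xy.
move: (x^T *m X *m x) (x^T *m X *m y) (y^T *m X *m x) (y^T *m X *m y) => p s s' t.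
by rewrite !mxE => ->; ring.
Qed.

(** Used in place of [mxE] so that matrix products stay atoms for [ring]. *)
Lemma mxDE k l (M N : 'M[R]_(k, l)) i j : (M + N) i j = M i j + N i j.
Proof. by rewrite mxE. Qed.

Lemma mxNE k l (M : 'M[R]_(k, l)) i j : (- M) i j = - M i j.
Proof. by rewrite mxE. Qed.

Lemma complete_square k l (S : 'M[R]_k) (U : 'M[R]_(l, k)) (F : 'M[R]_(k, l)) :
  sym S -> S \in unitmx ->
  (F + invmx S *m U^T)^T *m S *m (F + invmx S *m U^T) =
  F^T *m S *m F + F^T *m U^T + U *m F + U *m invmx S *m U^T.
Proof.
move=> symS uS; rewrite [(F + _)^T]linearD /= trmx_mul trmxK trmx_inv symS.
rewrite mulmxDl mulmxKV// mulmxDl !mulmxDr !mulmxA mulmxK// !addrA.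
by rewrite addrAC.
Qed.

End Positivity.

(** * Riccati expressions as minima over feedback gains *)

Section Riccati.
Variables (R : realType) (n m r : nat).
Variables (A Q : 'M[R]_n) (B L : 'M[R]_(n, m)) (Rw : 'M[R]_m).
Variables (A0 : 'I_r -> 'M[R]_n) (B0 : 'I_r -> 'M[R]_(n, m)).

Local Notation Lc := (Defs.Lc L A0 B0).
Local Notation Rc := (Defs.Rc Rw B0).
Local Notation Qc := (Defs.Qc Q A0).
Local Notation Ac := (Defs.Ac A B L Rw A0 B0).
Local Notation Gc := (Defs.Gc B Rw B0).
Local Notation Hc := (Defs.Hc Q L Rw A0 B0).
Local Notation Ric := (Defs.Ric A Q B L Rw A0 B0).
Local Notation newton_step := (Defs.newton_step A Q B L Rw A0 B0).

(** The form of the weight block matrix on the graph of [F], that is, at the vectors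
    [col_mx v (F *m v)]. *)
Definition cost (F : 'M[R]_(m, n)) : 'M[R]_n :=
  Q + L *m F + F^T *m L^T + F^T *m Rw *m F.

Definition care_gain (X Y : 'M[R]_n) : 'M[R]_(m, n) :=
  - (invmx (Rc Y) *m (X *m B + Lc Y)^T).

Definition care (X Y : 'M[R]_n) : 'M[R]_n :=
  A^T *m X + X *m A + Qc Y - (X *m B + Lc Y) *m invmx (Rc Y) *m (X *m B + Lc Y)^T.

Definition policy (X Y : 'M[R]_n) (F : 'M[R]_(m, n)) : 'M[R]_n :=
  lyap (A + B *m F) X + congr_sum (fun i => A0 i + B0 i *m F) Y + cost F.

Lemma qf_policy X Y F v : qf (policy X Y F) v = qf (lyap (A + B *m F) X) v +
  qf (congr_sum (fun i => A0 i + B0 i *m F) Y) v + qf (cost F) v.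
Proof. by rewrite /policy 2!qfD. Qed.

Lemma Ric_care X : Ric X = care X X.
Proof. by rewrite /Defs.Ric /care /Defs.Qc /Defs.Rc /Defs.Lc !addrA. Qed.

Lemma trmx_Pi12 Y : sym Y -> (Pi12 A0 B0 Y)^T = \sum_i (B0 i)^T *m Y *m A0 i.
Proof.
move=> symY; rewrite /Pi12 linear_sum; apply: eq_bigr => i _ /=.
by rewrite !trmx_mul trmxK symY mulmxA.
Qed.

Lemma congr_sum_gain Y F : sym Y -> congr_sum (fun i => A0 i + B0 i *m F) Y =
  Pi11 A0 Y + Pi12 A0 B0 Y *m F + F^T *m (Pi12 A0 B0 Y)^T + F^T *m Pi22 B0 Y *m F.
Proof.
move=> symY; rewrite trmx_Pi12// /Pi12 /Pi11 /Pi22 !mulmx_suml !mulmx_sumr mulmx_suml.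
rewrite -!big_split /=; apply: eq_bigr => i _.
rewrite [(A0 i + _)^T]linearD /= trmx_mul !(mulmxDl, mulmxDr) !mulmxA.
by rewrite !addrA; congr (_ + _); rewrite addrAC.
Qed.

Lemma pd_Rc Y : pd Rw -> sym Y -> psd Y -> pd (Rc Y).
Proof.
move=> [symR pdR] symY psdY; split.
  rewrite /sym /Defs.Rc linearD /= symR; congr (_ + _).
  by rewrite /Pi22 linear_sum; apply: eq_bigr => i _; rewrite /= !trmx_mul trmxK symY mulmxA.
move=> v v0; rewrite -/(qf _ _) /Defs.Rc qfD ltr_pwDl ?pdR//.
by rewrite /Pi22 qf_sum sumr_ge0// => i _; rewrite qf_congr; exact: psdY.
Qed.

(** The noise adds [Pi22 Y] to [Rw], so [policy] is quadratic in [F] with leading weight [Rc Y];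
    completing the square leaves [care]. *)
Lemma policyE X Y F : sym X -> sym Y -> pd (Rc Y) ->
  policy X Y F = care X Y + (F - care_gain X Y)^T *m Rc Y *m (F - care_gain X Y).
Proof.
move=> symX symY pdR; have [symRc _] := pdR; have uR := pd_unitmx pdR.
rewrite /policy /care /care_gain /cost /lyap congr_sum_gain// opprK.
set U := X *m B + Lc Y; rewrite complete_square//.
have -> : F^T *m U^T = F^T *m B^T *m X + F^T *m L^T + F^T *m (Pi12 A0 B0 Y)^T.
  rewrite /U /Defs.Lc [(_ + _)^T]linearD /= [(L + _)^T]linearD /= trmx_mul symX.
  by rewrite !mulmxDr !mulmxA addrA.
have -> : U *m F = X *m B *m F + L *m F + Pi12 A0 B0 Y *m F.
  by rewrite /U /Defs.Lc !mulmxDl addrA.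
have -> : F^T *m Rc Y *m F = F^T *m Rw *m F + F^T *m Pi22 B0 Y *m F.
  by rewrite /Defs.Rc mulmxDr mulmxDl.
rewrite [(A + _)^T]linearD /= trmx_mul mulmxDl mulmxDr !mulmxA /Defs.Qc.
by apply/matrixP => i j; rewrite !(mxDE, mxNE); ring.
Qed.

Lemma care_le_policy X Y F v : sym X -> sym Y -> pd (Rc Y) ->
  qf (care X Y) v <= qf (policy X Y F) v.
Proof.
move=> symX symY pdR; rewrite (policyE F symX symY pdR) qfD qf_congr lerDl.
exact: pd_psd.
Qed.

Lemma policy_gain X Y : sym X -> sym Y -> pd (Rc Y) ->
  policy X Y (care_gain X Y) = care X Y.
Proof. by move=> symX symY pdR; rewrite policyE// subrr mulmx0 addr0. Qed.

(** Expanding the quadratic term of [care] produces the coefficients [Ac], [Gc], [Hc] of the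
    equation that defines a step. *)
Lemma careE X Y : sym X -> sym Y -> pd (Rc Y) ->
  (Ac Y)^T *m X + X *m Ac Y - X *m Gc Y *m X + Hc Y = care X Y.
Proof.
move=> symX symY [symRc _].
have invT : (invmx (Rc Y))^T = invmx (Rc Y) by rewrite trmx_inv symRc.
rewrite /care /Defs.Ac /Defs.Gc /Defs.Hc; move: (invmx (Rc Y)) invT => V VT.
rewrite [(A - _)^T]linearB /= !trmx_mul trmxK VT [(X *m B + _)^T]linearD /= trmx_mul symX.
rewrite mulmxBl mulmxBr !(mulmxDl, mulmxDr) !mulmxA.
by apply/matrixP => i j; rewrite !(mxDE, mxNE); ring.
Qed.

Lemma closed_loopE X Y : sym X -> Ac Y - Gc Y *m X = A + B *m care_gain X Y.
Proof.
move=> symX; rewrite /Defs.Ac /Defs.Gc /care_gain [(X *m B + _)^T]linearD /= trmx_mul symX.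
rewrite mulmxN mulmxDr mulmxDr !mulmxA.
by apply/matrixP => i j; rewrite !(mxDE, mxNE); ring.
Qed.

(** * The kernel of the cost and stability of the closed loop *)

Section Assumptions.
Hypotheses (A1 : assumption1 Q L Rw) (A4 : assumption4 Q L Rw A0)
  (A5 : assumption5 A Q B L Rw).

Local Notation Qt := (Defs.Qt Q L Rw).

Let pdRw : pd Rw. Proof. by case: A1. Qed.
Let symRw : sym Rw. Proof. by case: pdRw. Qed.
Let symQ : sym Q.
Proof. by case: A1 => _ []; rewrite /sym tr_block_mx => /eq_block_mx[]. Qed.
Let symRi : (invmx Rw)^T = invmx Rw. Proof. by rewrite trmx_inv symRw. Qed.

Lemma cost_psd F : psd (cost F).
Proof.
move=> v; have [_ [_ /(_ (col_mx v (F *m v)))]] := A1.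
suff -> : (col_mx v (F *m v))^T *m block_mx Q L L^T Rw *m col_mx v (F *m v) =
  v^T *m cost F *m v by [].
rewrite -mulmxA mul_block_col tr_col_mx mul_row_col /cost trmx_mul.
rewrite !(mulmxDl, mulmxDr) !mulmxA.
by apply/matrixP => i j; rewrite !(mxDE, mxNE); ring.
Qed.

Lemma costE F : cost F =
  Qt + (F + invmx Rw *m L^T)^T *m Rw *m (F + invmx Rw *m L^T).
Proof.
have uR := pd_unitmx pdRw.
rewrite [(F + _)^T]linearD /= trmx_mul trmxK symRi /cost /Defs.Qt.
rewrite [(_ + _) *m Rw]mulmxDl mulmxKV// !(mulmxDl, mulmxDr) !mulmxA mulmxK//.
by apply/matrixP => i j; rewrite !(mxDE, mxNE); ring.
Qed.

Lemma sym_Qt : sym Qt.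
Proof. by rewrite /sym /Defs.Qt linearB /= !trmx_mul trmxK symRi symQ mulmxA. Qed.

Lemma Qt_psd : psd Qt.
Proof.
by have := cost_psd (- (invmx Rw *m L^T)); rewrite costE addNr mulmx0 addr0.
Qed.

Lemma sym_cost F : sym (cost F).
Proof.
rewrite costE /sym linearD /= sym_Qt; congr (_ + _).
by rewrite !trmx_mul trmxK symRw mulmxA.
Qed.

(** Both terms of [costE] are nonnegative, so both vanish; [Qt v = 0] gives [L^T v = 0] by
    assumption 4, and then definiteness of [Rw] gives [F v = 0]. *)
Lemma cost_kernel F v : qf (cost F) v = 0 ->
  [/\ Qt *m v = 0, F *m v = 0 & forall i, A0 i *m v = 0].
Proof.
rewrite costE qfD qf_congr => /eqP.
rewrite paddr_eq0; [|exact: Qt_psd|exact: pd_psd].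
move=> /andP[/eqP/(psd_kernel sym_Qt Qt_psd) Qv /eqP/(pd_eq0 pdRw)].
have [Lv Av] := A4 Qv.
by rewrite mulmxDl -mulmxA Lv mulmx0 addr0.
Qed.

(** A Hautus-type test: along a mode with [a >= 0] the Lyapunov, noise and cost terms are all
    nonnegative while their sum is nonpositive, so the cost vanishes there. *)
Lemma policy_stable X Y F : sym X -> psd X -> psd Y ->
  psd (- policy X Y F) -> stable (A + B *m F).
Proof.
move=> symX psdX psdY le0; apply: contrapT => /unstable_mode[a [b [x [y]]]].
case=> a_ge0; have [_ [K stK]] := A5.
move=> /negP nz ex ey; apply: nz; have hx := le0 x; have hy := le0 y.
move: hx hy; rewrite -!/(qf _ _) !qfN !qf_policy => hx hy.
have hl := qf_lyap_mode symX ex ey.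
have a0 : 0 <= 2 * a * (qf X x + qf X y).
  by rewrite mulr_ge0 ?mulr_ge0// addr_ge0//; exact: psdX.
have cx := congr_sum_ge0 (fun i => A0 i + B0 i *m F) x psdY.
have cy := congr_sum_ge0 (fun i => A0 i + B0 i *m F) y psdY.
have qx : 0 <= qf (cost F) x := cost_psd F x.
have qy : 0 <= qf (cost F) y := cost_psd F y.
have [Qx Fx _] : [/\ Qt *m x = 0, F *m x = 0 & forall i, A0 i *m x = 0].
  by apply: cost_kernel; lra.
have [Qy Fy _] : [/\ Qt *m y = 0, F *m y = 0 & forall i, A0 i *m y = 0].
  by apply: cost_kernel; lra.
(* On the mode [B F] and [K Qt] both vanish, so it is also a mode of the stable matrix
   [A + K Qt]. *)
have [||-> ->] := stable_mode stK a_ge0 (x := x) (y := y) (b := b); last by rewrite !eqxx.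
  by rewrite -ex !mulmxDl -!mulmxA Qx Fx !mulmx0.
by rewrite -ey !mulmxDl -!mulmxA Qy Fy !mulmx0.
Qed.

End Assumptions.
End Riccati.

(** * Entrywise limits of matrix sequences *)

Section EntrywiseLimits.
Variable R : realType.

(** Entrywise, so that limit laws reduce to those of real sequences; [mxcvg_cvg] returns to the
    topology of matrices. *)
Definition mxcvg m n (u : nat -> 'M[R]_(m, n)) (l : 'M[R]_(m, n)) :=
  forall i j, ((fun k => u k i j) @ \oo --> l i j)%classic.

Lemma mxcvg_cvg m n (u : nat -> 'M[R]_(m, n)) l : mxcvg u l -> (u @ \oo --> l)%classic.
Proof.
move=> ul S [P Pl PS]; rewrite /nbhs /= /nbhs /=.
have : (\forall k \near \oo, forall i j, P i j (u k i j))%classic.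
  apply: filter_forall => i; apply: filter_forall => j.
  exact: ul (Pl i j).
by apply: filterS => k Pk; apply: PS.
Qed.

Lemma mxcvg_cst m n (a : 'M[R]_(m, n)) : mxcvg (fun=> a) a.
Proof. by move=> i j; exact: cvg_cst. Qed.

Lemma mxcvgS m n (u : nat -> 'M[R]_(m, n)) l : mxcvg u l -> mxcvg (fun k => u k.+1) l.
Proof. by move=> ul i j; have := ul i j; rewrite -cvg_shiftS. Qed.

Lemma mxcvgD m n (u v : nat -> 'M[R]_(m, n)) a b :
  mxcvg u a -> mxcvg v b -> mxcvg (fun k => u k + v k) (a + b).
Proof.
move=> ua vb i j; rewrite mxE; under eq_fun do rewrite mxE.
by apply: cvgD; [exact: ua|exact: vb].
Qed.

Lemma mxcvgN m n (u : nat -> 'M[R]_(m, n)) a :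
  mxcvg u a -> mxcvg (fun k => - u k) (- a).
Proof.
by move=> ua i j; rewrite mxE; under eq_fun do rewrite mxE; apply: cvgN; exact: ua.
Qed.

Lemma mxcvgT m n (u : nat -> 'M[R]_(m, n)) a :
  mxcvg u a -> mxcvg (fun k => (u k)^T) a^T.
Proof. by move=> ua i j; rewrite mxE; under eq_fun do rewrite mxE; exact: ua. Qed.

Lemma cvgn_sum (I : finType) (f : I -> nat -> R) (l : I -> R) :
  (forall i, (f i @ \oo --> l i)%classic) ->
  ((fun k => \sum_i f i k) @ \oo --> \sum_i l i)%classic.
Proof.
move=> fl; elim: (index_enum I) => [|i s IH].
  by under eq_fun do rewrite big_nil; rewrite big_nil; exact: cvg_cst.
by under eq_fun do rewrite big_cons; rewrite big_cons; apply: cvgD.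
Qed.

Lemma mxcvgM m n p (u : nat -> 'M[R]_(m, n)) (v : nat -> 'M[R]_(n, p)) a b :
  mxcvg u a -> mxcvg v b -> mxcvg (fun k => u k *m v k) (a *m b).
Proof.
move=> ua vb i j; rewrite mxE; under eq_fun do rewrite mxE.
by apply: cvgn_sum => l; apply: cvgM; [exact: ua|exact: vb].
Qed.

Lemma mxcvg_sum m n r (u : 'I_r -> nat -> 'M[R]_(m, n)) a :
  (forall i, mxcvg (u i) (a i)) -> mxcvg (fun k => \sum_i u i k) (\sum_i a i).
Proof.
move=> ua i j; rewrite summxE; under eq_fun do rewrite summxE.
by apply: cvgn_sum => l; exact: ua.
Qed.

Lemma mxcvg_unique m n (u : nat -> 'M[R]_(m, n)) a b : mxcvg u a -> mxcvg u b -> a = b.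
Proof.
move=> ua ub; apply/matrixP => i j.
by rewrite -(cvg_lim _ (ua i j))// -(cvg_lim _ (ub i j)).
Qed.

Lemma mxcvg_qf n (u : nat -> 'M[R]_n) l v :
  mxcvg u l -> ((fun k => qf (u k) v) @ \oo --> qf l v)%classic.
Proof.
move=> ul; have H : mxcvg (fun k => v^T *m u k *m v) (v^T *m l *m v).
  by apply: mxcvgM; [apply: mxcvgM => //|]; exact: mxcvg_cst.
exact: H.
Qed.

(** Polarization: it lets limits of symmetric matrices be taken on their forms. *)
Lemma sym_entry n (M : 'M[R]_n) i j : sym M ->
  M i j = (qf M (delta_mx i 0 + delta_mx j 0) - qf M (delta_mx i 0) - qf M (delta_mx j 0)) / 2.
Proof.
move=> symM; rewrite qf_addv// trmx_delta -rowE -colE !mxE.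
by field.
Qed.

Lemma qf_mxcvg n (u : nat -> 'M[R]_n) (l : 'M[R]_n) :
  (forall k, sym (u k)) -> sym l ->
  (forall v, ((fun k => qf (u k) v) @ \oo --> qf l v)%classic) -> mxcvg u l.
Proof.
move=> symu syml ul i j; rewrite sym_entry//.
under eq_fun do rewrite sym_entry//.
by apply: cvgM; last exact: cvg_cst; apply: cvgB; [apply: cvgB|]; exact: ul.
Qed.

(** Each sequence [qf (u k) v] decreases and is bounded below by 0; polarization assembles the
    limits into a matrix. *)
Lemma psd_nonincreasing_cvg n (u : nat -> 'M[R]_n) :
  (forall k, sym (u k)) -> (forall k, psd (u k)) ->
  (forall k, psd (u k - u k.+1)) -> exists l, [/\ sym l, psd l & mxcvg u l].
Proof.
move=> symu psdu decr.
have qcvg v : cvgn (fun k => qf (u k) v).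
  apply: nonincreasing_is_cvgn.
    apply/nonincreasing_seqP => k.
    by rewrite -subr_ge0 -qfB; exact: decr.
  by exists 0 => _ [k _ <-]; exact: psdu.
pose q v := limn (fun k => qf (u k) v).
pose d (i : 'I_n) : 'cV[R]_n := delta_mx i 0.
pose l : 'M[R]_n := \matrix_(i, j) ((q (d i + d j) - q (d i) - q (d j)) / 2).
have ul : mxcvg u l.
  move=> i j; rewrite mxE; under eq_fun do rewrite sym_entry//.
  by apply: cvgM; last exact: cvg_cst; apply: cvgB; [apply: cvgB|]; exact: qcvg.
exists l; split => //.
  by apply/matrixP => i j; rewrite !mxE addrC [d j + d i]addrC; congr (_ / 2); ring.
move=> v; have vl : ((fun k => qf (u k) v) @ \oo --> qf l v)%classic by exact: mxcvg_qf.
rewrite -/(qf l v) -(cvg_lim _ vl)//; apply: limr_ge; first by apply/cvg_ex; exists (qf l v).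
by near=> k; exact: psdu.
Unshelve. all: by end_near.
Qed.

End EntrywiseLimits.

(** * Newton steps: existence, monotonicity, convergence *)

Section Iteration.
Variables (R : realType) (n m r : nat).
Variables (A Q : 'M[R]_n) (B L : 'M[R]_(n, m)) (Rw : 'M[R]_m).
Variables (A0 : 'I_r -> 'M[R]_n) (B0 : 'I_r -> 'M[R]_(n, m)).
Hypotheses (A1 : assumption1 Q L Rw) (A4 : assumption4 Q L Rw A0)
  (A5 : assumption5 A Q B L Rw).

Local Notation Ric := (Defs.Ric A Q B L Rw A0 B0).
Local Notation newton_step := (Defs.newton_step A Q B L Rw A0 B0).
Local Notation policy := (policy A Q B L Rw A0 B0).
Local Notation care := (care A Q B L Rw A0 B0).
Local Notation care_gain := (care_gain B L Rw A0 B0).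
Local Notation cost := (cost Q L Rw).

Let pdR Y : sym Y -> psd Y -> pd (Rc Rw B0 Y).
Proof. by move=> symY psdY; apply: pd_Rc => //; case: A1. Qed.

Lemma psd_ge (X Y : 'M[R]_n) : psd (X - Y) -> psd Y -> psd X.
Proof.
move=> XY Y0 v; have := XY v; have := Y0 v; rewrite -!/(qf _ _) qfB; lra.
Qed.

Lemma newton_stepP P Y : sym P -> psd P -> newton_step P Y <->
  [/\ sym Y, care Y P = 0 & stable (A + B *m care_gain Y P)].
Proof.
move=> symP psdP; split=> [[symY]|[symY]].
  by rewrite careE ?closed_loopE//; [case|exact: pdR].
by move=> e st; split=> //; rewrite careE ?closed_loopE//; exact: pdR.
Qed.

Lemma care_gain_stable X Y : sym X -> psd X -> sym Y -> psd Y ->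
  psd (- care X Y) -> stable (A + B *m care_gain X Y).
Proof.
move=> symX psdX symY psdY le0; apply: (policy_stable (B0 := B0) A1 A4 A5 symX psdX psdY).
by rewrite policy_gain//; exact: pdR.
Qed.

(** With the noise frozen at [P], the condition on [Z] is a Lyapunov equation with right-hand side
    [- W], where [W] is semidefinite. *)
Lemma policy_evaluation F P : stable (A + B *m F) -> sym P -> psd P ->
  exists Z, [/\ sym Z, psd Z & policy Z P F = 0].
Proof.
move=> st symP psdP.
pose W := congr_sum (fun i => A0 i + B0 i *m F) P + cost F.
have symW : sym (- W).
  by rewrite /sym linearN /W linearD /= sym_congr_sum// (sym_cost A1).
have [Z symZ ZW] := lyapunov_solvable st symW.
exists Z; split=> //; last by rewrite -[LHS]/(lyap _ _ + _ + _) -addrA -/W /lyap ZW addNr.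
apply: (lyapunov_psd st symZ); rewrite ZW opprK => v.
by rewrite -/(qf _ _) /W qfD addr_ge0 ?congr_sum_ge0//; exact: cost_psd.
Qed.

(** One Kleinman step, evaluating the gain of [Z]. At this gain [Z] has policy [care Z P <= 0] and
    [Z'] has policy 0, whence [Z' <= Z]; minimality of [care] gives [care Z' P <= 0]. *)
Lemma policy_improvement P Z : sym P -> psd P -> sym Z -> psd Z -> psd (- care Z P) ->
  exists Z', [/\ sym Z', psd Z', psd (- care Z' P), psd (Z - Z') &
    policy Z' P (care_gain Z P) = 0].
Proof.
move=> symP psdP symZ psdZ le0; have pdRP := pdR symP psdP.
have st := care_gain_stable symZ psdZ symP psdP le0.
have [Z' [symZ' psdZ' e]] := policy_evaluation st symP psdP.
exists Z'; split=> //.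
  move=> v; rewrite -/(qf _ _) qfN oppr_ge0 (le_trans (care_le_policy A Q B L A0 (care_gain Z P) v symZ' symP pdRP))//.
  by rewrite e qf0.
apply: (lyap_le st) => // v.
have := le0 v; rewrite -/(qf _ _) qfN -(policy_gain A Q B L A0 symZ symP pdRP) qf_policy.
by have := congr1 (fun M => qf M v) e; rewrite qf_policy qf0; lra.
Qed.

(* Kleinman's iteration started at [P]: its values decrease and stay nonnegative, and
   the limit inherits stability from [care_gain_stable]. *)
Lemma newton_step_exists P : sym P -> psd P -> psd (- Ric P) -> exists Y, newton_step P Y.
Proof.
move=> symP psdP; rewrite Ric_care => le0.
pose good Z := [/\ sym Z, psd Z & psd (- care Z P)].
(* The implication makes the step a total map, with default value [Z] outside [good]. *)
have /choice[f hf] Z : exists Z', good Z ->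
    [/\ good Z', psd (Z - Z') & policy Z' P (care_gain Z P) = 0].
  have [[symZ psdZ leZ]|ngood] := pselect (good Z); last by exists Z.
  have [Z' [? ? ? ? ?]] := policy_improvement symP psdP symZ psdZ leZ.
  by exists Z'.
pose u k := iter k f P.
have good_u k : good (u k).
  by elim: k => [|k IH]; [split|have [] := hf _ IH].
have step k := hf _ (good_u k).
have [Y [symY psdY uY]] : exists l, [/\ sym l, psd l & mxcvg u l].
  by apply: psd_nonincreasing_cvg => k; [case: (good_u k)|case: (good_u k)|case: (step k)].
have gainY : mxcvg (fun k => care_gain (u k) P) (care_gain Y P).
  apply: mxcvgN; apply: mxcvgM; first exact: mxcvg_cst.
  apply: mxcvgT; apply: mxcvgD; last exact: mxcvg_cst.
  by apply: mxcvgM => //; exact: mxcvg_cst.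
have loopY (N : 'M[R]_n) (K : 'M[R]_(n, m)) :
    mxcvg (fun k => N + K *m care_gain (u k) P) (N + K *m care_gain Y P).
  by apply: mxcvgD; [|apply: mxcvgM => //]; exact: mxcvg_cst.
(* The gain lags one index behind the value; these policies are all 0, and so is their limit
   [care Y P]. *)
have policyY : mxcvg (fun k => policy (u k.+1) P (care_gain (u k) P))
    (policy Y P (care_gain Y P)).
  have uYS := mxcvgS uY.
  apply: mxcvgD; first apply: mxcvgD; first apply: mxcvgD.
  - by apply: mxcvgM => //; apply: mxcvgT; exact: loopY.
  - by apply: mxcvgM => //; exact: loopY.
  - apply: mxcvg_sum => i; apply: mxcvgM; last exact: loopY.
    by apply: mxcvgM; [apply: mxcvgT; exact: loopY|exact: mxcvg_cst].
  - apply: mxcvgD; first apply: mxcvgD; first apply: mxcvgD.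
    + exact: mxcvg_cst.
    + by apply: mxcvgM => //; exact: mxcvg_cst.
    + by apply: mxcvgM; [exact: mxcvgT|exact: mxcvg_cst].
    + by apply: mxcvgM => //; apply: mxcvgM; [exact: mxcvgT|exact: mxcvg_cst].
have careY : care Y P = 0.
  rewrite -(policy_gain A Q B L A0 symY symP (pdR symP psdP)).
  apply: (mxcvg_unique policyY); rewrite (_ : (fun k => _) = fun=> 0).
    exact: mxcvg_cst.
  by apply/funext => k; have [] := step k.
exists Y; apply/newton_stepP => //; split=> //.
apply: care_gain_stable => //; rewrite careY oppr0 => v.
by rewrite -/(qf _ _) qf0.
Qed.

Variable Xs : 'M[R]_n.
Hypotheses (symXs : sym Xs) (psdXs : psd Xs) (RicXs : Ric Xs = 0).

Lemma newton_step_monotone P Y : sym P -> psd (P - Xs) -> psd (- Ric P) ->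
  newton_step P Y -> [/\ psd (P - Y), psd (Y - Xs) & psd (- Ric Y)].
Proof.
move=> symP PXs le0; have psdP := psd_ge PXs psdXs; have pdRP := pdR symP psdP.
move=> /newton_stepP-/(_ symP psdP)[symY careY st].
have stP : stable (A + B *m care_gain P P).
  by apply: care_gain_stable => //; rewrite -Ric_care.
have PY : psd (P - Y).
  (* With [F] the gain of [P]: [policy P P F = Ric P <= 0 = care Y P <= policy Y P F], and the noise
     and cost terms agree. *)
  apply: (lyap_le stP) => // v.
  have := care_le_policy A Q B L A0 (care_gain P P) v symY symP pdRP.
  rewrite careY qf0 qf_policy; have := le0 v; rewrite -/(qf _ _) qfN.
  by rewrite Ric_care -(policy_gain A Q B L A0 symP symP pdRP) qf_policy; lra.
have e v : qf (policy Y P (care_gain Y P)) v = 0 by rewrite policy_gain// careY qf0.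
have YXs : psd (Y - Xs).
  (* With [F = care_gain Y P]: [policy Y P F = 0 = Ric Xs <= policy Xs Xs F <= policy Xs P F], the
     last because [Xs <= P]. *)
  apply: (lyap_le st) => // v.
  have := care_le_policy A Q B L A0 (care_gain Y P) v symXs symXs (pdR symXs psdXs).
  have := congr_sum_le (fun i => A0 i + B0 i *m care_gain Y P) v PXs.
  by rewrite -Ric_care RicXs qf0; have := e v; rewrite !qf_policy; lra.
have psdY := psd_ge YXs psdXs.
split=> // v; rewrite -/(qf _ _) qfN oppr_ge0 Ric_care.
(* For the same gain, [Ric Y <= policy Y Y F <= policy Y P F = 0], since [Y <= P]. *)
apply: (le_trans (care_le_policy A Q B L A0 (care_gain Y P) v symY symY (pdR symY psdY))).
rewrite -(e v) !qf_policy lerD2r lerD2l.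
exact: congr_sum_le.
Qed.

Let Fs := care_gain Xs Xs.
Let Ms := A + B *m Fs.
Let Ns i := A0 i + B0 i *m Fs.

Let policyXs : policy Xs Xs Fs = 0.
Proof. by rewrite policy_gain -?Ric_care//; exact: pdR. Qed.

(** Subtracting [policy Xs Xs Fs = 0] from [0 = care Y P <= policy Y P Fs] bounds [lyap Ms (Y - Xs)]
    below by minus the noise of [P - Xs], hence by [lyap Ms (s *: Xs)]; [lyap_le] concludes. *)
Lemma newton_step_dominated s P Y : sym P -> psd P -> newton_step P Y ->
  (forall v, qf (congr_sum Ns (P - Xs)) v <= s * (qf (congr_sum Ns Xs) v + qf (cost Fs) v)) ->
  psd (s *: Xs - (Y - Xs)).
Proof.
move=> symP psdP /newton_stepP-/(_ symP psdP)[symY careY _] dom.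
have stXs : stable Ms.
  apply: care_gain_stable => // v; rewrite -Ric_care RicXs oppr0.
  by rewrite -/(qf _ _) qf0.
apply: (lyap_le stXs).
- by rewrite /sym linearZ /= symXs.
- by rewrite /sym linearB /= symY symXs.
move=> v; have := dom v.
have -> : qf (lyap Ms (s *: Xs)) v = s * qf (lyap Ms Xs) v.
  by rewrite /lyap -scalemxAr -scalemxAl -scalerDr qfZ.
have := congr1 (fun M => qf M v) policyXs; rewrite qf_policy qf0 -/Ms -/Ns => eXs.
have -> : qf (lyap Ms Xs) v = - (qf (congr_sum Ns Xs) v + qf (cost Fs) v) by lra.
have := care_le_policy A Q B L A0 Fs v symY symP (pdR symP psdP).
rewrite careY qf0 qf_policy lyapB qfB -/Ms -/Ns.
have -> : qf (congr_sum Ns (P - Xs)) v = qf (congr_sum Ns P) v - qf (congr_sum Ns Xs) v.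
  by rewrite !qf_congr_sum -sumrB; apply: eq_bigr => i _; rewrite qfB.
lra.
Qed.

(* By assumption 4 the noise matrices [Ns i] vanish on the kernel of [cost Fs]. *)
Lemma noise_dominated P : exists2 c : R, 0 <= c &
  forall v, qf (congr_sum Ns P) v <= c * qf (cost Fs) v.
Proof.
apply: psd_dominates_sum; [exact: sym_cost A1 Fs|exact: cost_psd|].
move=> i v Wv; have [|_ Fv Av] := cost_kernel A1 A4 (F := Fs) (v := v).
  by rewrite /qf -mulmxA Wv mulmx0 mxE.
by rewrite mulmxDl Av -mulmxA Fv mulmx0 addr0.
Qed.

(** The bound [X k.+1 - Xs <= c q^k Xs], proved by induction, squeezes the forms of [X k - Xs] to
    0. *)
Lemma newton_cvg (X : nat -> 'M[R]_n) : sym (X 0%N) ->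
  (forall k, psd (X k - Xs)) -> (forall k, newton_step (X k) (X k.+1)) -> mxcvg X Xs.
Proof.
move=> symX0 XXs step.
have symX k : sym (X k) by case: k => // k; have [] := step k.
have psdX k := psd_ge (XXs k) psdXs.
have [c c0 hc] := noise_dominated (X 0%N - Xs).
have [d d0 hd] := noise_dominated Xs.
(* If [N] is the noise of [Xs] and [W] its cost, [N <= d W] amounts to [N <= q (N + W)]: [q] is the
   contraction factor. *)
pose q := d / (1 + d).
have d1 : 0 < 1 + d by rewrite ltr_pwDl.
have q0 : 0 <= q by rewrite divr_ge0// ltW.
have q1 : q < 1 by rewrite ltr_pdivrMr// mul1r ltrDr.
have bound k : psd ((c * q ^+ k) *: Xs - (X k.+1 - Xs)).
  elim: k => [|k IH].
    (* The first step turns the bound [c] on the noise of [X 0 - Xs] into a multiple of [Xs]; hence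
       the shifted index. *)
    apply: (newton_step_dominated (symX 0%N) (psdX 0%N) (step 0%N)) => v.
    rewrite expr0 mulr1 mulrDr (le_trans (hc v))// lerDr mulr_ge0//.
    exact: congr_sum_ge0.
  apply: (newton_step_dominated (symX _) (psdX _) (step _)) => v.
  rewrite (le_trans (congr_sum_le _ _ IH))//.
  have -> : qf (congr_sum Ns ((c * q ^+ k) *: Xs)) v = c * q ^+ k * qf (congr_sum Ns Xs) v.
    by rewrite !qf_congr_sum mulr_sumr; apply: eq_bigr => i _; rewrite qfZ.
  rewrite exprSr mulrA -[leRHS]mulrA ler_wpM2l ?mulr_ge0 ?exprn_ge0//.
  rewrite /q mulrAC ler_pdivlMr// mulrDr mulr1 mulrDr [leRHS]addrC [_ * d]mulrC lerD2r.
  exact: hd.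
apply: qf_mxcvg => // v.
suff : ((fun k => qf (X k - Xs) v) @ \oo --> 0)%classic.
  move=> h; rewrite -[qf Xs v]add0r.
  under eq_fun do rewrite -[qf (X _) v](subrK (qf Xs v)) -qfB.
  by apply: cvgD => //; exact: cvg_cst.
rewrite -cvg_shiftS /=.
apply: (@squeeze_cvgr _ _ _ _ (cst 0) (fun k => c * q ^+ k * qf Xs v)).
- near=> k; rewrite /= XXs /=.
  by rewrite -subr_ge0 -qfZ -qfB; exact: bound.
- exact: cvg_cst.
have -> : 0 = c * 0 * qf Xs v by rewrite mulr0 mul0r.
apply: cvgM; last exact: cvg_cst; apply: cvgM; first exact: cvg_cst.
by apply: cvg_expr; rewrite ger0_norm.
Unshelve. all: by end_near.
Qed.

End Iteration.

Theorem theorem3p4 (R : realType) (n m r : nat)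
  (A Q : 'M[R]_n) (B L : 'M[R]_(n, m)) (Rw : 'M[R]_m)
  (A0 : 'I_r -> 'M[R]_n) (B0 : 'I_r -> 'M[R]_(n, m)) :
  assumption1 Q L Rw ->
  assumption2 A B A0 B0 ->
  assumption3 A Q B L Rw A0 B0 ->
  assumption4 Q L Rw A0 ->
  assumption5 A Q B L Rw ->
  forall Xs : 'M[R]_n, sym Xs -> psd Xs -> Ric A Q B L Rw A0 B0 Xs = 0 ->
  forall X0 : 'M[R]_n, sym X0 -> psd (X0 - Xs) ->
    stable (Ac A B L Rw A0 B0 X0 - Gc B Rw B0 X0 *m X0) ->
    psd (- Ric A Q B L Rw A0 B0 X0) ->
  (* the iteration is well defined *)
  (exists X : nat -> 'M[R]_n, X 0%N = X0 /\
     forall k, newton_step A Q B L Rw A0 B0 (X k) (X k.+1)) /\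
  (* and any such iteration satisfies (i) and (ii) *)
  (forall X : nat -> 'M[R]_n, X 0%N = X0 ->
     (forall k, newton_step A Q B L Rw A0 B0 (X k) (X k.+1)) ->
     (forall k, psd (X k - X k.+1) /\ psd (X k - Xs) /\
                psd (- Ric A Q B L Rw A0 B0 (X k))) /\
     (X @ \oo --> Xs)%classic).
Proof.
move=> A1 _ _ A4 A5 Xs symXs psdXs RicXs X0 symX0 X0Xs _ Ric0.
pose ns := newton_step A Q B L Rw A0 B0.
(* The properties of the starting matrix that every step reproduces. *)
pose inv P := [/\ sym P, psd (P - Xs) & psd (- Ric A Q B L Rw A0 B0 P)].
have mono P Y : inv P -> ns P Y -> inv Y /\ psd (P - Y).
  move=> [symP PXs leP] stepPY.
  have [PY YXs leY] := newton_step_monotone A1 A4 A5 symXs psdXs RicXs symP PXs leP stepPY.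
  by split=> //; split=> //; case: stepPY.
have ex P : inv P -> exists Y, ns P Y.
  move=> [symP PXs leP].
  exact: (newton_step_exists A1 A4 A5 symP (psd_ge PXs psdXs) leP).
split.
  have /choice[f hf] P : exists Y, inv P -> ns P Y.
    have [invP|ninv] := pselect (inv P); last by exists P.
    by have [Y PY] := ex _ invP; exists Y.
  exists (fun k => iter k f X0); split=> // k.
  suff invX : inv (iter k f X0) by exact: hf.
  by elim: k => [|k IH]; [split|have [] := mono _ _ IH (hf _ IH)].
move=> X XX0 step.
have invX k : inv (X k).
  by elim: k => [|k IH]; [rewrite XX0; split|have [] := mono _ _ IH (step k)].
split.
  by move=> k; have [_ XXs leX] := invX k; have [] := mono _ _ (invX k) (step k).
apply: mxcvg_cvg; apply: (newton_cvg A1 A4 A5 symXs psdXs RicXs) => //.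
  by rewrite XX0.
by move=> k; have [] := invX k.
Qed.
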